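(* Let $F$ be a vector field on a Lie group $G$ with left-trivialization $f(g)=g^{-1}\cdot F(g)\in\mathfrak g$, let $\tau:\mathfrak g\to G$ be a retraction, and let $\Delta t>0$ be the time step. Consider the discrete Lie--Poisson adjoint equations $$(d\tau^{-1}_{\Delta t\xi_{k+1}})^*m_{k+1}-\mathrm{Ad}^*_{\tau(\Delta t\xi_k)}(d\tau^{-1}_{\Delta t\xi_k})^*m_k=-\Delta t\,g_k^*[Df(g_k)]^*m_{k+1},$$ $$\xi_{k+1}=f(g_k),$$ $$g_{k+1}=g_k\,\tau(\Delta t\,\xi_{k+1})=g_k\,\tau(\Delta t\,f(g_k)),$$ for $g_k\in G$, $\xi_k\in\mathfrak g$, $m_k\in\mathfrak g^*$, and the discrete variational equation $$\Delta t\,d\tau_{\Delta t\xi_{k+1}}Df(g_k)g_k\eta_k=-\eta_k+\mathrm{Ad}_{\tau(\Delta t\xi_{k+1})}\eta_{k+1}$$ for $\eta_k\in\mathfrak g$. Then the discrete Lie--Poisson adjoint equations and the discrete variational equation satisfy the following quadratic conservation law: $$\big\langle(d\tau^{-1}_{-\Delta t\xi_{k+1}})^*m_{k+1},\eta_{k+1}\big\rangle=\big\langle(d\tau^{-1}_{-\Delta t\xi_k})^*m_k,\eta_k\big\rangle.$$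
   Context: All manifolds and maps are smooth unless otherwise stated. $\mathfrak g$ is the Lie algebra of $G$ and $\langle\cdot,\cdot\rangle$ is the duality pairing. With $L_g(x)=gx$: $g^{-1}\cdot v_g:=T_gL_{g^{-1}}(v_g)\in\mathfrak g$ for $v_g\in T_gG$; $g\eta:=T_eL_g(\eta)\in T_gG$ for $\eta\in\mathfrak g$; $g^*p_g:=T_e^*L_g(p_g)\in\mathfrak g^*$ (where $T_e^*L_g$ is the dual of $T_eL_g$) for $p_g\in T_g^*G$. $Df(g):T_gG\to\mathfrak g$ is the derivative of $f$ and $[Df(g)]^*:\mathfrak g^*\to T_g^*G$ its dual. The $\eta_k=g_k^{-1}\delta g_k$ are left-trivialized variations of the points $g_k$, and the two systems are taken along the same sequence $\{g_k\}$. A retraction $\tau:\mathfrak g\to G$ is a map that is a $C^2$-diffeomorphism about the origin with $\tau(0)=e$. $d\tau_\xi:\mathfrak g\to\mathfrak g$ is the right-trivialized tangent map of $\tau$, i.e. $T_\xi\tau(\eta)=T_eR_{\tau(\xi)}(d\tau_\xi\eta)$ with $R_g(x)=xg$; $d\tau_\xi^{-1}$ is the inverse of $d\tau_\xi$, and $(d\tau_\xi^{-1})^*:\mathfrak g^*\to\mathfrak g^*$ is the dual of $d\tau_\xi^{-1}$. $\mathrm{Ad}^*_g$ is the dual of $\mathrm{Ad}_g$: $\langle\mathrm{Ad}^*_g\mu,\eta\rangle=\langle\mu,\mathrm{Ad}_g\eta\rangle$.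
   Formalization: The retraction is additionally assumed to satisfy τ(−ξ)=τ(ξ)^{-1} for all ξ (without it the law fails, e.g. G=(R,+), τ(x)=x+x²); dτ at Δtξ_k is assumed to exist and be invertible. *)

(* Defs.v *)
From HB Require Import structures.
From mathcomp Require Import all_boot all_order all_algebra.
From mathcomp Require Import all_classical all_reals all_analysis.

Set Implicit Arguments.
Unset Strict Implicit.
Unset Printing Implicit Defensive.
Import Order.TTheory GRing.Theory Num.Theory.
Import numFieldNormedType.Exports.
Local Open Scope classical_set_scope.
Local Open Scope ring_scope.

(* To be used with A open and V finite-dimensional: the successor step asks for
   directional derivatives of class C^k, which then amounts to 'd f being so. *)
Fixpoint Ck_on (R : realType) (V W : normedModType R) (k : nat)
    (A : set V) (f : V -> W) : Prop :=
  match k with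
  | 0 => forall x, A x -> {for x, continuous f}
  | k'.+1 => (forall x, A x -> differentiable f x) /\
             (forall v : V, Ck_on k' A (fun x => 'd f x v))
  end.

Definition smooth_on (R : realType) (V W : normedModType R)
    (A : set V) (f : V -> W) : Prop :=
  forall k, Ck_on k A f.

(* The atlas is given as a family of charts (chart p) indexed by the points of
   M, the p-th one being defined around p.  The maps chart p and chart_inv p
   are total; only their values on chart_dom p and on
   chart p @` chart_dom p matter. *)
HB.mixin Record Topological_isManifold (R : realType) (n : nat) M
    of Topological M := {
  chart_dom : M -> set M;
  chart : M -> M -> 'rV[R]_n;
  chart_inv : M -> 'rV[R]_n -> M;
  manifold_hausdorff : hausdorff_space M;
  manifold_second_countable : @second_countable M;
  chart_dom_open : forall p, open (chart_dom p);
  chart_dom_center : forall p, chart_dom p p;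
  chart_cod_open : forall p, open (chart p @` chart_dom p);
  chartK : forall p, {in chart_dom p, cancel (chart p) (chart_inv p)};
  chart_continuous : forall p x, chart_dom p x -> {for x, continuous (chart p)};
  chart_inv_continuous : forall p u, (chart p @` chart_dom p) u ->
    {for u, continuous (chart_inv p)};
  chart_transition_smooth : forall p q,
    smooth_on (chart p @` (chart_dom p `&` chart_dom q))
              (chart q \o chart_inv p)
}.

#[short(type="manifoldType")]
HB.structure Definition Manifold (R : realType) (n : nat) :=
  {M of Topological_isManifold R n M & Topological M}.

Definition chart_cod (R : realType) (n : nat) (M : manifoldType R n) (p : M) :
  set 'rV[R]_n := chart p @` chart_dom p.

HB.mixin Record Manifold_Group_isLie (R : realType) (n : nat) G
    of Manifold R n G & Group G := {
  lie_mulg_continuous : continuous (fun xy : G * G => (xy.1 * xy.2)%g);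
  lie_mulg_smooth : forall p q : G,
    smooth_on
      [set uv : 'rV[R]_n * 'rV[R]_n |
        [/\ chart_cod p uv.1, chart_cod q uv.2
          & chart_dom (p * q)%g (chart_inv p uv.1 * chart_inv q uv.2)%g]]
      (fun uv => chart (p * q)%g (chart_inv p uv.1 * chart_inv q uv.2)%g);
  lie_invg_continuous : continuous (fun x : G => (x^-1)%g);
  lie_invg_smooth : forall p : G,
    smooth_on
      [set u : 'rV[R]_n | chart_cod p u /\
        chart_dom (p^-1)%g ((chart_inv p u)^-1)%g]
      (fun u => chart (p^-1)%g ((chart_inv p u)^-1)%g)
}.

#[short(type="lieGroupType")]
HB.structure Definition LieGroup (R : realType) (n : nat) :=
  {G of Manifold_Group_isLie R n G & Manifold R n G & Group G}.

(* A tangent vector at p is represented by its coordinates in the chart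
   attached to p.  In particular, propositionally equal base points (such as
   g^-1 * g and 1) have convertible tangent spaces, with the same
   coordinates. *)
Definition tangent (R : realType) (n : nat) (M : manifoldType R n) (p : M) :=
  'rV[R]_n.

Section Tangent.
Context {R : realType} {n n' m : nat}.

Definition tangent_map (M : manifoldType R n) (M' : manifoldType R n')
    (f : M -> M') (p : M) : 'Hom(tangent p, tangent (f p)) :=
  linfun ('d (chart (f p) \o f \o chart_inv p) (chart p p)).

Definition tangent_map_to (M : manifoldType R n) (f : M -> 'rV[R]_m) (p : M) :
    'Hom(tangent p, 'rV[R]_m) :=
  linfun ('d (f \o chart_inv p) (chart p p)).

Definition tangent_map_from (M : manifoldType R n) (f : 'rV[R]_m -> M)
    (x : 'rV[R]_m) : 'Hom('rV[R]_m, tangent (f x)) :=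
  linfun ('d (chart (f x) \o f) x).

End Tangent.

Definition smooth_vector_field (R : realType) (n : nat)
    (M : manifoldType R n) (F : forall p : M, tangent p) : Prop :=
  forall p : M, smooth_on (chart_cod p)
    (fun u => tangent_map_to (chart p) (chart_inv p u) (F (chart_inv p u))).

Definition dual_map (R : realType) (V W : vectType R) (A : 'Hom(V, W))
  (mu : 'Hom(W, R^o)) : 'Hom(V, R^o) := (mu \o A)%VF.

Section LieGroupTheory.
Context {R : realType} {n : nat} {G : lieGroupType R n}.

Definition lie_algebra := tangent (1%g : G).

(* g . eta := T_e L_g eta *)
Definition ltrans (g : G) : 'Hom(lie_algebra, tangent g) :=
  tangent_map (fun x : G => (g * x)%g) 1%g.

(* g^-1 . v := T_g L_{g^-1} v *)
Definition ltriv (g : G) : 'Hom(tangent g, lie_algebra) :=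
  tangent_map (fun x : G => (g^-1 * x)%g) g.

Definition rtrans (g : G) : 'Hom(lie_algebra, tangent g) :=
  tangent_map (fun x : G => (x * g)%g) 1%g.

Definition Ad (g : G) : 'End(lie_algebra) :=
  tangent_map (fun x : G => (g * x * g^-1)%g) 1%g.

Definition left_trivialization (F : forall g : G, tangent g) (g : G) :
  lie_algebra := ltriv g (F g).

Definition C2_diffeo_on (U : set lie_algebra) (tau : lie_algebra -> G) : Prop :=
  [/\ forall xi, U xi -> {for xi, continuous tau},
      forall p : G,
        Ck_on 2 (U `&` tau @^-1` chart_dom p) (chart p \o tau),
      open (tau @` U)
    & exists2 sigma : G -> lie_algebra,
        {in U, cancel tau sigma}
      & forall p : G,
          Ck_on 2 (chart_cod p `&` chart_inv p @^-1` (tau @` U))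
            (sigma \o chart_inv p) ].

Definition retraction (tau : lie_algebra -> G) : Prop :=
  tau 0 = 1%g /\
  exists U : set lie_algebra, [/\ open U, U 0 & C2_diffeo_on U tau].

(* The solution of T_xi tau = T_e R_{tau xi} \o dtau_xi. *)
Definition dtau (tau : lie_algebra -> G) (xi : lie_algebra) :
    'End(lie_algebra) :=
  ((rtrans (tau xi))^-1 \o tangent_map_from tau xi)%VF.

Definition dtau_inv (tau : lie_algebra -> G) (xi : lie_algebra) :
  'End(lie_algebra) := ((dtau tau xi)^-1)%VF.

(* What the notation dtau_xi^-1 presupposes at xi; it holds near 0 for any
   retraction. *)
Definition dtau_invertible (tau : lie_algebra -> G) (xi : lie_algebra) : Prop :=
  [/\ {for xi, continuous tau},
      differentiable (chart (tau xi) \o tau) xi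
    & bijective (dtau tau xi)].

(* A standing property of the retractions used in Lie group integrators (exp,
   Cayley); it gives dtau_xi = Ad_{tau xi} \o dtau_{- xi}.  It does not follow
   from [retraction]: consider xi + xi ^ 2 on the additive group of reals. *)
Definition inverse_symmetric (tau : lie_algebra -> G) : Prop :=
  forall xi, tau (- xi) = ((tau xi)^-1)%g.

Definition discrete_adjoint_step (f : G -> lie_algebra) (tau : lie_algebra -> G)
    (dt : R) (g : nat -> G) (xi : nat -> lie_algebra)
    (m : nat -> 'Hom(lie_algebra, R^o)) (k : nat) : Prop :=
  [/\ dual_map (dtau_inv tau (dt *: xi k.+1)) (m k.+1)
      - dual_map (Ad (tau (dt *: xi k)))
          (dual_map (dtau_inv tau (dt *: xi k)) (m k))
      = - (dt *: dual_map (ltrans (g k))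
                   (dual_map (tangent_map_to f (g k)) (m k.+1))),
      xi k.+1 = f (g k)
    & g k.+1 = (g k * tau (dt *: xi k.+1))%g ].

Definition discrete_variational_step (f : G -> lie_algebra)
    (tau : lie_algebra -> G) (dt : R) (g : nat -> G) (xi : nat -> lie_algebra)
    (eta : nat -> lie_algebra) (k : nat) : Prop :=
  dt *: dtau tau (dt *: xi k.+1) (tangent_map_to f (g k) (ltrans (g k) (eta k)))
  = - eta k + Ad (tau (dt *: xi k.+1)) (eta k.+1).

End LieGroupTheory.

Arguments lie_algebra {R n} G.

(* Main.v *)
Require Import Defs.
From HB Require Import structures.
From mathcomp Require Import all_boot all_order all_algebra.
From mathcomp Require Import all_classical all_reals all_analysis.
Set Implicit Arguments.
Unset Strict Implicit.
Unset Printing Implicit Defensive.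
Import Order.TTheory GRing.Theory Num.Theory.
Import numFieldNormedType.Exports.
Local Open Scope classical_set_scope.
Local Open Scope ring_scope.

(** The statement is linear algebra once one identity of retractions is known:
    with [t = tau xi],
      dtau_xi = Ad_t \o dtau_(- xi),   hence
      dtau_(- xi)^-1 = dtau_xi^-1 \o Ad_t.
    Substituting the latter in both sides of the conservation law, the pairing
    at [k] becomes [<m_k, dtau_k^-1 (Ad eta_k)>], which is the term subtracted
    in the adjoint equation, paired with [eta_k]; applying [dtau_(k+1)^-1] to the
    variational equation and pairing with [m_(k+1)] turns the other terms into
    the pairing at [k.+1] ([adjoint_variational_pairing]).

    The identity ([Ad_dtauN]) comes from differentiating
    [tau y * tau (- y) = 1] at [xi]:
      T R_(t^-1) (T_xi tau v) = T L_t (T_(- xi) tau v).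
    The left-hand side is [dtau_xi v], because [T R_(t^-1)] inverts [T_e R_t]
    ([rtrans_inv]).  The right-hand side is [Ad_t (dtau_(- xi) v)]: since
    [dtau_(- xi) v] is the derivative of [tau y * t] at [- xi], its image by
    [Ad_t] is that of [t * (tau y * t) * t^-1 = t * tau y].

    All these derivatives are taken in the charts attached to the relevant
    points.  Equal points may be written differently ([t * t^-1] and [1]), so
    derivatives are handled by a relation, [tangent_at], in which the target
    point is an argument that can be rewritten; it satisfies the chain rule
    ([tangent_at_comp]) and a product rule ([tangent_at_mulg]). *)

(** * Differentials are local *)

Lemma is_diff_near0 (R : realType) (V W : normedModType R) (f : V -> W)
    (x : V) :
  (\forall y \near x, f y = 0) -> is_diff x f (0 : V -> W).
Proof.
move=> f0.
have fx : f x = 0 by exact: nbhs_singleton f0.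
have e : f \o shift x = cst (f x) + (0 : V -> W) +o_ (0 : V) id.
  have f0x : \forall h \near (0 : V), f (h + x) = 0.
    by move: f0; rewrite (near_shift 0) /= subr0.
  apply/eqaddoP => _/posnumP[eps]; near=> h.
  rewrite /= !fctE fx !(subr0, addr0, add0r).
  suff -> : f (h + x) = 0 by rewrite normr0 mulr_ge0.
  by near: h.
have c : continuous (\0 : {linear V -> W}) by exact: cst_continuous.
have d0 := diff_unique c e.
apply: DiffDef; last by [].
by apply/diff_locallyP; rewrite d0.
Unshelve. all: by end_near. Qed.

Lemma is_diff_near (R : realType) (V W : normedModType R) (f g df : V -> W)
    (x : V) :
  (\forall y \near x, f y = g y) -> is_diff x f df -> is_diff x g df.
Proof.
move=> fg dfx.
have d0 : is_diff x (g - f) (0 : V -> W).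
  apply: is_diff_near0; apply: filterS fg => y fgy.
  by rewrite !fctE fgy subrr.
have := is_diffD dfx d0.
by rewrite addr0 addrC subrK.
Qed.

(** * Linear algebra *)

(** In finite dimension a left inverse, even one not known to be linear, is the
    inverse. *)
Lemma lfun_inv_cancel (K : fieldType) (vT : vectType K) (f : 'End(vT))
    (h : vT -> vT) : cancel f h -> (f^-1)%VF =1 h.
Proof.
move=> fK v; have f0 : lker f == 0%VS by apply/lker0P/(can_inj fK).
by rewrite -[in RHS](lker0_lfunVK f0 v) fK.
Qed.

(** The pairing of the two equations, with [D], [E] standing for
    [dtau_(k+1)] and [dtau_k^-1], [A], [B] for the two adjoint actions, and
    [J \o L] for the linearized vector field: the term in [J] is common to the
    adjoint equation tested on [u] and to [mu \o D^-1] applied to the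
    variational equation. *)
Lemma adjoint_variational_pairing (R : realType) (V : vectType R)
    (D E A B J L : 'End(V)) (mu nu : 'Hom(V, R^o)) (u v : V) (dt : R) :
  dual_map D^-1 mu - dual_map B (dual_map E nu) =
    - (dt *: dual_map L (dual_map J mu)) ->
  lker D == 0%VS ->
  dt *: D (J (L u)) = - u + A v ->
  mu (D^-1%VF (A v)) = nu (E (B u)).
Proof.
move=> /lfunP/(_ u) adj kerD var.
rewrite /dual_map !(add_lfunE, opp_lfunE, scale_lfunE, comp_lfunE) in adj *.
have -> : (D^-1)%VF (A v) = dt *: J (L u) + (D^-1)%VF u.
  rewrite -[J (L u)](lker0_lfunK kerD) -linearZ -linearD /= var.
  by rewrite addrAC addNr add0r.
have -> x y : mu (dt *: x + y) = dt *: mu x + mu y by rewrite linearP.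
by move/eqP: adj; rewrite subr_eq => /eqP ->; rewrite addrA subrr add0r.
Qed.

(** * Derivatives of maps into a manifold *)

Section TangentAt.
Context {R : realType} {n : nat} {M : manifoldType R n}.
Implicit Types (V W : normedModType R) (p q : M).

(** The base point [p] is an argument rather than [phi x], so that the chart in
    which the derivative [L] is expressed can be changed by rewriting [p]. *)
Definition tangent_at V (phi : V -> M) (x : V) (p : M) (L : V -> 'rV[R]_n) :=
  [/\ phi x = p, {for x, continuous phi} & is_diff x (chart p \o phi) L].

Lemma tangent_at_unique V (phi : V -> M) x p q L K :
  tangent_at phi x p L -> tangent_at phi x q K -> L = K.
Proof. by case=> <- _ [_ <-] [<- _ [_ <-]]. Qed.

Lemma tangent_at_near V (phi psi : V -> M) x p L :
  (\forall y \near x, phi y = psi y) ->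
  tangent_at phi x p L -> tangent_at psi x p L.
Proof.
move=> e [phix cphi dphi]; split.
- by rewrite -(nbhs_singleton e).
- rewrite /prop_for /continuous_at -(nbhs_singleton e).
  exact: cvg_trans (near_eq_cvg e) cphi.
- by apply: is_diff_near dphi; apply: filterS e => y /= ->.
Qed.

Lemma tangent_at_ext V (phi psi : V -> M) x p L :
  phi =1 psi -> tangent_at phi x p L -> tangent_at psi x p L.
Proof. by move=> /funext ->. Qed.

Lemma tangent_at_cst V x p : tangent_at (fun _ : V => p) x p 0.
Proof. by split => //; [exact: cvg_cst | exact: is_diff_cst]. Qed.

(** This makes [tangent_map f p] the derivative of [f \o chart_inv p], so that
    maps between manifolds need no notion of derivative of their own. *)
Lemma tangent_at_chart_inv p : tangent_at (chart_inv p) (chart p p) p id.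
Proof.
have pp : chart_inv p (chart p p) = p.
  by apply: chartK; rewrite inE; exact: chart_dom_center.
have cp : (chart p @` chart_dom p) (chart p p).
  by exists p => //; exact: chart_dom_center.
split => //; first exact: chart_inv_continuous.
apply: (@is_diff_near _ _ _ id).
apply: filterS (open_nbhs_nbhs (conj (chart_cod_open p) cp)).
by move=> _ [y py <-] /=; rewrite chartK // inE.
Qed.

Lemma tangent_at_precomp V W (h : V -> W) (phi : W -> M) x p L T :
  is_diff x h L -> tangent_at phi (h x) p T ->
  tangent_at (phi \o h) x p (T \o L).
Proof.
move=> dh [phix cphi dphi]; split => //.
- by apply: continuous_comp => //; apply: differentiable_continuous.
- exact: (@is_diff_comp _ _ _ _ h L (chart p \o phi) T).
Qed.

Lemma tangent_at_chartK V (phi : V -> M) x p L :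
  tangent_at phi x p L -> \forall y \near x, chart_inv p (chart p (phi y)) = phi y.
Proof.
move=> [phix cphi _].
have : \forall y \near x, chart_dom p (phi y).
  apply: cphi; rewrite phix; apply: open_nbhs_nbhs; split.
    exact: chart_dom_open.
  exact: chart_dom_center.
by apply: filterS => y yp; rewrite chartK // inE.
Qed.

End TangentAt.

(** Continuity of [f] at [p] is not lost by looking at it through [chart_inv p]:
    near [x], [f \o phi] factors through [chart p \o phi]. *)
Lemma tangent_at_comp (R : realType) (n n' : nat) (M : manifoldType R n)
    (M' : manifoldType R n') (V : normedModType R) (phi : V -> M) (f : M -> M')
    x p q L T :
  tangent_at phi x p L -> tangent_at (f \o chart_inv p) (chart p p) q T ->
  tangent_at (f \o phi) x q (T \o L).
Proof.
move=> tphi tf.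
have [phix _ dphi] := tphi.
apply: (@tangent_at_near _ _ _ _ ((f \o chart_inv p) \o (chart p \o phi))).
  by apply: filterS (tangent_at_chartK tphi) => y /= ->.
by apply: tangent_at_precomp => //=; rewrite phix.
Qed.

Lemma tangent_mapE (R : realType) (n n' : nat) (M : manifoldType R n)
    (M' : manifoldType R n') (f : M -> M') p q T v :
  tangent_at (f \o chart_inv p) (chart p p) q T -> tangent_map f p v = T v.
Proof.
move=> tf; have [pp _ _] := tangent_at_chart_inv p.
have [+ _ [_ <-]] := tf.
by rewrite /= pp => <-; rewrite lfunE.
Qed.

Lemma tangent_map_fromE (R : realType) (n m : nat) (M : manifoldType R n)
    (phi : 'rV[R]_m -> M) x p T v :
  tangent_at phi x p T -> tangent_map_from phi x v = T v.
Proof. by move=> [<- _ [_ <-]]; rewrite lfunE. Qed.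

(** * Differentiating group operations *)

Section LieGroup.
Context {R : realType} {n : nat} {G : lieGroupType R n}.
Implicit Types (V : normedModType R) (p q : G).

(** The differential of the group law, read in charts at [(p, q)].  Its partial
    maps [dmulg p q (u, 0)] and [dmulg p q (0, v)] are [T_p R_q u] and
    [T_q L_p v]. *)
Definition dmulg p q : 'rV[R]_n * 'rV[R]_n -> 'rV[R]_n :=
  'd (fun uv => chart (p * q)%g (chart_inv p uv.1 * chart_inv q uv.2)%g)
     (chart p p, chart q q).

Lemma dmulgB (p q : G) u v :
  dmulg p q (u, - v) = dmulg p q (u, 0) - dmulg p q (0, v).
Proof.
rewrite /dmulg -linearB; congr ('d _ _ _).
by congr pair; rewrite /= ?subr0 ?sub0r.
Qed.

Lemma tangent_at_mulg V (phi psi : V -> G) x p q L K :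
  tangent_at phi x p L -> tangent_at psi x q K ->
  tangent_at (fun y => (phi y * psi y)%g) x (p * q)%g
    (fun v => dmulg p q (L v, K v)).
Proof.
move=> tphi tpsi; have [phix cphi dphi] := tphi; have [psix cpsi dpsi] := tpsi.
have [pp cpp _] := tangent_at_chart_inv p.
have [qq cqq _] := tangent_at_chart_inv q.
pose mu (uv : 'rV[R]_n * 'rV[R]_n) := (chart_inv p uv.1 * chart_inv q uv.2)%g.
have tmu : tangent_at mu (chart p p, chart q q) (p * q)%g (dmulg p q).
  split; first by rewrite /mu /= pp qq.
    have cp : (fun uv : 'rV[R]_n * 'rV[R]_n => chart_inv p uv.1) @
        (chart p p, chart q q) --> chart_inv p (chart p p).
      exact: (@cvg_comp _ _ _ fst (chart_inv p) _ _ _ cvg_fst cpp).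
    have cq : (fun uv : 'rV[R]_n * 'rV[R]_n => chart_inv q uv.2) @
        (chart p p, chart q q) --> chart_inv q (chart q q).
      exact: (@cvg_comp _ _ _ snd (chart_inv q) _ _ _ cvg_snd cqq).
    exact: (cvg_comp _ (fun xy : G * G => (xy.1 * xy.2)%g) (cvg_pair cp cq)
             (lie_mulg_continuous (chart_inv p (chart p p), chart_inv q (chart q q)))).
  apply: differentiableP.
  have [+ _] := lie_mulg_smooth p q 1%N.
  apply; split => /=; rewrite ?pp ?qq; last exact: chart_dom_center.
    by exists p => //; exact: chart_dom_center.
  by exists q => //; exact: chart_dom_center.
apply: (@tangent_at_near _ _ _ _
   (mu \o (fun y => ((chart p \o phi) y, (chart q \o psi) y)))).
  apply: filterS2 (tangent_at_chartK tphi) (tangent_at_chartK tpsi).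
  by move=> y /= phiy psiy; rewrite /mu /= phiy psiy.
apply: (tangent_at_precomp (is_diff_pair dphi dpsi)).
by rewrite /= phix psix.
Qed.

Lemma tangent_at_invg p :
  exists T, tangent_at (fun u => ((chart_inv p u)^-1)%g) (chart p p) (p^-1)%g T.
Proof.
have [pp cpp _] := tangent_at_chart_inv p.
eexists; split; first by rewrite pp.
  apply: (continuous_comp cpp); exact: lie_invg_continuous.
apply: differentiableP.
have [+ _] := lie_invg_smooth p 1%N.
apply; split; last by rewrite pp; exact: chart_dom_center.
by exists p => //; exact: chart_dom_center.
Qed.

Lemma tangent_at_mulgl V (phi : V -> G) x p q L :
  tangent_at phi x q L ->
  tangent_at (fun y => (p * phi y)%g) x (p * q)%g (fun v => dmulg p q (0, L v)).
Proof. exact: tangent_at_mulg (tangent_at_cst _ _). Qed.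

Lemma tangent_at_mulgr V (phi : V -> G) x p q L :
  tangent_at phi x p L ->
  tangent_at (fun y => (phi y * q)%g) x (p * q)%g (fun v => dmulg p q (L v, 0)).
Proof. by move=> tphi; exact: tangent_at_mulg tphi (tangent_at_cst _ _). Qed.

(** * Trivialized derivatives of a retraction *)

(** Differentiate [x * q * q^-1 = x] at [x = 1]. *)
Lemma rtrans_inv (q : G) v : ((rtrans q)^-1)%VF v = dmulg q (q^-1)%g (v, 0).
Proof.
move: v; apply: (@lfun_inv_cancel R 'rV[R]_n) => u.
have tq := tangent_at_mulgr q (tangent_at_chart_inv (1%g : G)).
rewrite /rtrans (tangent_mapE _ tq).
move: tq; rewrite mul1g => /(tangent_at_mulgr (q^-1)%g) tq'.
have e y :
    (chart_inv 1 y * q * q^-1)%g = chart_inv 1%g y.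
  by rewrite mulgK.
have := tangent_at_unique (tangent_at_ext e tq') (tangent_at_chart_inv _).
by move/(congr1 (fun h => h u)).
Qed.

(** The right-hand side is the derivative at [a] of [tau y * t^-1]. *)
Lemma dtauE (tau : lie_algebra G -> G) (a : lie_algebra G) t T v :
  tangent_at tau a t T -> dtau tau a v = dmulg t (t^-1)%g (T v, 0).
Proof.
move=> ttau; rewrite /dtau comp_lfunE (tangent_map_fromE _ ttau) rtrans_inv.
by case: ttau => ->.
Qed.

(** Up to sign, the two sides are the two terms that the product rule gives for
    the derivative at [a] of the constant map [tau y * tau (- y)]. *)
Lemma Ad_dtauN (tau : lie_algebra G -> G) (a v : lie_algebra G) :
  inverse_symmetric tau -> dtau_invertible tau a ->
  Ad (tau a) (dtau tau (- a) v) = dtau tau a v.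
Proof.
move=> tauV [ctau dtau_a _].
set t := tau a.
have ttau : tangent_at tau a t ('d (chart t \o tau) a).
  by split => //; exact: differentiableP.
set T := 'd _ _ in ttau.
have tautN (x : 'rV[R]_n) p S : tangent_at tau x p S ->
    tangent_at (fun y => tau (- y)) (- x) p (fun w => S (- w)).
  move=> h.
  have dN := @is_diffN R 'rV[R]_n 'rV[R]_n id id (- x) (is_diff_id _).
  by apply: (tangent_at_precomp dN); rewrite /= !fctE opprK.
(* Differentiability at [- a] is transported from [a] by smoothness of the
   group inverse. *)
have [S ttauN] : exists S : {linear 'rV[R]_n -> 'rV[R]_n},
    tangent_at tau (- a) (t^-1)%g S.
  have [I tI] := tangent_at_invg t.
  have := tangent_at_comp (tautN _ _ _ ttau) tI.
  have -> : (fun x : G => (x^-1)%g) \o (fun y => tau (- y)) = tau.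
    by apply/funext => y /=; rewrite tauV invgK.
  move=> [? ? [? _]]; exists ('d (chart (t^-1)%g \o tau) (- a)).
  by split => //; exact: differentiableP.
rewrite [RHS](dtauE v ttau) [X in Ad _ X = _](dtauE v ttauN) invgK.
(* The minus sign of the product rule is absorbed by the derivative of
   [- y]. *)
have tprod : dmulg t (t^-1)%g (T v, 0) = dmulg t (t^-1)%g (0, S v).
  apply/eqP; rewrite -subr_eq0 -dmulgB -linearN; apply/eqP.
  have := tautN _ _ _ ttauN; rewrite opprK => h.
  have tp := tangent_at_mulg ttau h.
  have e y : (tau y * tau (- y))%g = 1%g.
    by rewrite tauV mulgV.
  by have /(congr1 (fun f => f v)) :=
    tangent_at_unique (tangent_at_ext e tp) (tangent_at_cst _ _).
rewrite tprod.
have tpsi := tangent_at_mulgr t ttauN; rewrite mulVg in tpsi.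
(* [S v] translated to the identity is the derivative of [tau y * t], which
   conjugation by [t] turns into [t * tau y]. *)
have tconj := tangent_at_mulgr (t^-1)%g
  (tangent_at_mulgl t (tangent_at_chart_inv 1%g)).
rewrite /Ad (@tangent_mapE _ _ _ _ _ (fun x => (t * x * t^-1)%g) _ _ _ _ tconj).
have e y : (t * (tau y * t) * t^-1)%g = (t * tau y)%g.
  by rewrite mulgA mulgK.
have tc := tangent_at_comp tpsi (f := fun x => (t * x * t^-1)%g) tconj.
have := tangent_at_unique (tangent_at_ext e tc) (tangent_at_mulgl t ttauN).
by move/(congr1 (fun f => f v)).
Qed.

Lemma dtau_invN (tau : lie_algebra G -> G) (a w : lie_algebra G) :
  inverse_symmetric tau -> dtau_invertible tau a ->
  dtau_inv tau (- a) w = dtau_inv tau a (Ad (tau a) w).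
Proof.
move=> tauV da; have [_ _ /bij_inj inj_da] := da.
move: w; apply: lfun_inv_cancel => v; rewrite Ad_dtauN // /dtau_inv.
by rewrite lker0_lfunK //; apply/lker0P.
Qed.

Lemma dual_dtau_invN (tau : lie_algebra G -> G) (a w : lie_algebra G)
    (mu : 'Hom(lie_algebra G, R^o)) :
  inverse_symmetric tau -> dtau_invertible tau a ->
  dual_map (dtau_inv tau (- a)) mu w = mu (dtau_inv tau a (Ad (tau a) w)).
Proof.
move=> tauV da; rewrite [LHS]comp_lfunE.
by congr (mu _); exact: dtau_invN.
Qed.

End LieGroup.

Theorem theorem4p4 (R : realType) (n : nat) (G : lieGroupType R n)
    (F : forall g : G, tangent g) (hF : smooth_vector_field F)
    (tau : lie_algebra G -> G) (htau : retraction tau)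
    (htauV : inverse_symmetric tau)
    (dt : R) (hdt : 0 < dt) (N : nat)
    (g : nat -> G) (xi : nat -> lie_algebra G)
    (m : nat -> 'Hom(lie_algebra G, R^o)) (eta : nat -> lie_algebra G)
    (hdtau : forall k, (k <= N)%N -> dtau_invertible tau (dt *: xi k))
    (hadj : forall k, (k < N)%N ->
       discrete_adjoint_step (left_trivialization F) tau dt g xi m k)
    (hvar : forall k, (k < N)%N ->
       discrete_variational_step (left_trivialization F) tau dt g xi eta k) :
  forall k, (k < N)%N ->
    dual_map (dtau_inv tau (- (dt *: xi k.+1))) (m k.+1) (eta k.+1) =
    dual_map (dtau_inv tau (- (dt *: xi k))) (m k) (eta k).
Proof.
move=> k kN.
have dk := hdtau _ (ltnW kN); have dk1 := hdtau _ kN.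
have [adj _ _] := hadj _ kN.
have [_ _ /bij_inj inj] := dk1.
rewrite [LHS](dual_dtau_invN _ _ htauV dk1) [RHS](dual_dtau_invN _ _ htauV dk).
apply: (adjoint_variational_pairing (V := 'rV[R]_n) adj); first exact/lker0P.
exact: hvar.
Qed.
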